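(* Let $A, B > 0$ be real constants and let $(R_L)_{L\geq0}$ be a sequence of Lebesgue measurable subsets of $[0,1)$ such that for every $L$, $\mathbb{P}(R_L) \geq B^{-L}$ and $R_L$ is a disjoint union of at most $A^L$ intervals. Then for almost all $\alpha \in [0,1)$ and every $\eta > 0$, there are infinitely many $L$ for which there exists a positive integer $h_L$ with $$h_L \leq (1+\eta)^L \frac{1}{\mathbb{P}(R_L)} \qquad\text{and}\qquad \{h_L \alpha\} \in R_L.$$
   Context: $\mathbb{P}$ denotes one-dimensional Lebesgue measure; $\{x\}$ denotes the fractional part of a real number $x$. *)

(* Defs.v *)
From Stdlib Require Import Reals Lra List.
Open Scope R_scope.

Record interval := mkInterval { lo : R; hi : R; lo_closed : bool; hi_closed : bool }.

Definition in_interval (I : interval) (x : R) : Prop :=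
  (if lo_closed I then lo I <= x else lo I < x) /\
  (if hi_closed I then x <= hi I else x < hi I).

Definition ilength (I : interval) : R := Rmax 0 (hi I - lo I).

Definition in_union (l : list interval) (x : R) : Prop :=
  exists I, In I l /\ in_interval I x.

Definition pairwise_disjoint (l : list interval) : Prop :=
  forall i j (d : interval) x, (i < length l)%nat -> (j < length l)%nat -> i <> j ->
    in_interval (nth i l d) x -> in_interval (nth j l d) x -> False.

(* Total length = Lebesgue measure of the union when pairwise disjoint *)
Definition total_length (l : list interval) : R :=
  fold_right (fun I s => ilength I + s) 0 l.

Definition lebesgue_null (N : R -> Prop) : Prop :=
  forall eps, 0 < eps ->
    exists a b : nat -> R,
      (forall n, a n <= b n) /\
      (forall x, N x -> exists n, a n < x < b n) /\
      (forall m, sum_f_R0 (fun n => b n - a n) m <= eps).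

(* Main.v *)
(* Restrict [h] to the primes [p] in [(P, H]], where [H] is about [(1 + eta)^L / mu],
   [mu = P(R_L)] and [P] is half the number of primes up to [H], and sample [alpha]
   on a grid [a / N] with [N] divisible by all these [p].  Let [E] be the set of
   grid points that no [p] sends into [R_L], and [e] its centred indicator.
   Averaging over the shifts by [1 / p] defines commuting projections [P_p].
   Since [E] is disjoint from [{a : p a in R_L}], which is invariant under these
   shifts, Cauchy-Schwarz gives [|E|^2 mu <= ||P_p e||^2] for densities.  On the
   other hand [E] consists of exponentially (in [L]) many runs, so a product of
   [K] projections with [P^K] larger than that nearly kills [e]; as each [p]
   exceeds a fixed power of [(1 + eta)^L], the number [K] does not depend on [L].
   Hence [sum_p ||P_p e||^2] is at most about [K ||e||^2 <= K |E|], and [|E|^2] is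
   at most a constant over [mu] times the number of primes, which by Chebyshev's
   bound tends to zero. *)
From mathcomp Require all_boot all_order all_algebra zify ring lra.
From Stdlib Require ZArith Reals Lra FunctionalExtensionality ClassicalEpsilon.
Require Defs.

(** * Chebyshev's lower bound for the number of primes *)

Module Primes.

Import all_boot zify.zify.
Set Implicit Arguments.
Unset Strict Implicit.
Unset Printing Implicit Defensive.

(** Legendre's formula padded with zero terms, so that the sums for [n!] and [(2n)!] share one
    range. *)
Lemma logn_fact_widen p n m : prime p -> n <= m ->
  logn p n`! = \sum_(1 <= k < m.+1) n %/ p ^ k.
Proof.
move=> pr_p le_nm; rewrite logn_fact // [RHS](big_cat_nat (n := n.+1)) //=.
rewrite [X in _ = _ + X]big_nat_cond [X in _ = _ + X]big1 ?addn0 // => k.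
rewrite andbT => /andP[lt_nk _]; apply: divn_small.
exact: ltn_trans lt_nk (ltn_expl k (prime_gt1 pr_p)).
Qed.

(** By Legendre's formula the exponent is the sum over [k] of [2n %/ p^k - 2 (n %/ p^k)]. Each term
    is 0 or 1, and it vanishes once [p^k > 2n]. *)
Lemma logn_central_bin p n : prime p ->
  logn p 'C(n.*2, n) <= trunc_log p n.*2.
Proof.
move=> pr_p; have p_gt1 := prime_gt1 pr_p.
have le_n2 : n <= n.*2 by rewrite -addnn leq_addl.
have /(congr1 (logn p)) := bin_fact le_n2.
have -> : n.*2 - n = n by rewrite -addnn addnK.
rewrite !lognM ?muln_gt0 ?fact_gt0 ?bin_gt0 //.
rewrite (logn_fact_widen pr_p (leqnn n.*2)) (logn_fact_widen pr_p le_n2) -big_split /=.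
set t := trunc_log p n.*2 => E.
suff: \sum_(1 <= k < n.*2.+1) n.*2 %/ p ^ k <=
      t + \sum_(1 <= k < n.*2.+1) (n %/ p ^ k + n %/ p ^ k).
  by rewrite -E leq_add2r.
have -> : t = \sum_(1 <= k < n.*2.+1) (k <= t).
  have le_t : t <= n.*2.
    by case: (posnP n.*2) => [z|/(trunc_logP p_gt1) h];
       [rewrite /t z trunc_log0|exact: ltnW (leq_trans (ltn_expl t p_gt1) h)].
  rewrite (big_cat_nat (n := t.+1)) //=.
  rewrite [X in X + _]big_nat_cond (eq_bigr (fun=> 1)); last first.
    by move=> k; rewrite andbT ltnS => /andP[_ ->].
  rewrite -big_nat_cond sum_nat_const_nat muln1 subn1 /=.
  rewrite big_nat_cond big1 ?addn0 // => k.
  by rewrite andbT => /andP[h _]; rewrite leqNgt h.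
rewrite -big_split /=; apply: leq_sum => k _.
have pk_gt0 : 0 < p ^ k by rewrite expn_gt0 prime_gt0.
case: (leqP k t) => [_|lt_tk].
  rewrite -ltnS ltn_divLR // addnn; have := ltn_ceil n pk_gt0; nia.
rewrite divn_small //; apply: leq_trans (trunc_log_ltn _ p_gt1) _.
by rewrite leq_exp2l.
Qed.

Lemma prime_dvd_fact p n : prime p -> p %| n`! -> p <= n.
Proof.
move=> pr_p; elim: n => [|n IHn]; first by rewrite dvdn1 => /eqP p1; rewrite p1 in pr_p.
rewrite factS Euclid_dvdM // => /orP[/dvdn_leq-> // | /IHn/leq_trans-> //].
Qed.

Lemma leq_exp2r_weak a b e : a <= b -> a ^ e <= b ^ e.
Proof. by case: e => // e; rewrite leq_exp2r. Qed.

Definition primes_in (a b : nat) : seq nat := [seq p <- index_iota a b | prime p].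

Lemma mem_primes_in a b p : (p \in primes_in a b) = [&& a <= p, p < b & prime p].
Proof. by rewrite mem_filter mem_index_iota andbC andbA. Qed.

Lemma uniq_primes_in a b : uniq (primes_in a b).
Proof. by rewrite filter_uniq // iota_uniq. Qed.

Lemma size_primes_in_cat a b c : a <= b -> b <= c ->
  size (primes_in a c) = size (primes_in a b) + size (primes_in b c).
Proof.
move=> ab bc; rewrite /primes_in -size_cat -filter_cat /index_iota.
have -> : c - a = (b - a) + (c - b) by lia.
by rewrite iotaD subnKC.
Qed.

Lemma size_primes_in a b : size (primes_in a b) <= b - a.
Proof. by rewrite size_filter (leq_trans (count_size _ _)) // size_iota. Qed.

Lemma expn2_central_bin n : 2 ^ n <= 'C(n.*2, n).
Proof.
elim: n => [|n IHn]; first by rewrite bin0.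
rewrite doubleS binS expnS mul2n -addnn; apply: leq_add.
  by apply: leq_trans IHn _; rewrite binS leq_addl.
by apply: leq_trans IHn _; apply: leq_bin2l.
Qed.

(** Every prime power in the factorisation is at most [2n] by [logn_central_bin], and only primes up
    to [2n] occur, since the binomial divides [(2n)!]. *)
Lemma central_bin_le n : 0 < n ->
  'C(n.*2, n) <= n.*2 ^ size (primes_in 0 n.*2.+1).
Proof.
move=> n_gt0; have C_gt0 : 0 < 'C(n.*2, n) by rewrite bin_gt0 -addnn leq_addl.
rewrite [X in X <= _]prod_prime_decomp // prime_decompE big_map /=.
have le_pow (s : seq nat) : (forall p, p \in s -> prime p) ->
    \prod_(p <- s) p ^ logn p 'C(n.*2, n) <= n.*2 ^ size s.
  elim: s => [|p s IHs] prs; first by rewrite big_nil.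
  rewrite big_cons expnS; apply: leq_mul; last first.
    by apply: IHs => q qs; apply: prs; rewrite inE qs orbT.
  have pr_p : prime p by apply: prs; rewrite inE eqxx.
  apply: leq_trans (trunc_logP (prime_gt1 pr_p) _); last by rewrite double_gt0.
  by rewrite leq_exp2l ?prime_gt1 // logn_central_bin.
apply: leq_trans (le_pow _ _) _.
  by move=> p; rewrite mem_primes => /and3P[].
rewrite leq_pexp2l ?double_gt0 //; apply: uniq_leq_size; first exact: primes_uniq.
move=> p; rewrite mem_primes mem_primes_in /= => /and3P[pr_p _ dv].
rewrite pr_p andbT ltnS.
have: p %| (n.*2)`! by rewrite -(bin_fact (m := n)) ?dvdn_mulr // -addnn leq_addl.
exact: prime_dvd_fact.
Qed.

(** Here [t] stands in for the binary logarithm of [H]. For [n = H./2], the chain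
    [2^n <= 'C(2n, n) <= (2n)^pi(2n)] together with [2n <= H < 2^t] allows exponents of 2 to be
    compared. *)
Lemma chebyshev_lower_bound H t : H < 2 ^ t ->
  H./2 <= t * size (primes_in 0 H.+1).
Proof.
move=> lt_H; case: (posnP H./2) => [-> //|h_gt0].
set n := H./2 in h_gt0 *; have le_nH : n.*2 <= H.
  by rewrite -[X in _ <= X]odd_double_half leq_addl.
have : 2 ^ n <= 2 ^ (t * size (primes_in 0 n.*2.+1)).
  apply: leq_trans (expn2_central_bin n) _.
  apply: leq_trans (central_bin_le h_gt0) _.
  by rewrite expnM leq_exp2r_weak // (leq_trans le_nH (ltnW lt_H)).
rewrite leq_exp2l // => /leq_trans; apply; rewrite leq_mul2l.
by rewrite [in X in _ || X](@size_primes_in_cat 0 n.*2.+1 H.+1) ?leq_addr ?orbT.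
Qed.

End Primes.

(** * Averages over shifts of a cyclic grid *)

Module Grid.

Import all_boot all_order all_algebra zify.zify.
Import mathcomp.algebra_tactics.ring mathcomp.algebra_tactics.lra.
Import FunctionalExtensionality.
Set Implicit Arguments.
Unset Strict Implicit.
Unset Printing Implicit Defensive.
Import Order.TTheory GRing.Theory Num.Theory.
Local Open Scope ring_scope.

Definition periodic {T : Type} (n : nat) (g : nat -> T) := forall a, g (a + n)%N = g a.

(** On functions of period [d * s] this is the orthogonal projection onto those of period [s]; the
    projection [P_p] is the case [d = p], [s = N %/ p]. *)
Definition avg {F : realFieldType} (d s : nat) (g : nat -> F) : nat -> F :=
  fun a => (\sum_(i < d) g (a + i * s)%N) / d%:R.

Definition energy {F : realFieldType} (N : nat) (g : nat -> F) : F :=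
  \sum_(a < N) g a ^+ 2.

Definition variation {F : realFieldType} (N : nat) (g : nat -> F) : F :=
  \sum_(a < N) `|g a.+1 - g a|.

Lemma periodicM {T : Type} n (g : nat -> T) k : periodic n g -> periodic (k * n) g.
Proof.
move=> pg; elim: k => [|k IHk] a; first by rewrite addn0.
by rewrite mulSn [(n + _)%N]addnC addnA pg IHk.
Qed.

Section Averages.
Context {F : realFieldType}.
Implicit Types (g h u : nat -> F).

Lemma sum_shift n g s : periodic n g -> \sum_(i < n) g (i + s)%N = \sum_(i < n) g i.
Proof.
move=> pg; elim: s => [|s <-]; first by under eq_bigr do rewrite addn0.
case: n pg => [|n] pg; first by rewrite !big_ord0.
rewrite big_ord_recr [RHS]big_ord_recl /= addrC; congr (_ + _).
  by rewrite add0n -[RHS]pg addnS addnC addnS.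
by apply: eq_bigr => i _; rewrite addnS.
Qed.

Lemma sum_periodic_mul n g d : periodic n g ->
  \sum_(i < d * n) g i = (\sum_(i < n) g i) *+ d.
Proof.
move=> pg; elim: d => [|d IHd]; first by rewrite mul0n big_ord0.
rewrite mulSn big_split_ord mulrS -IHd /=; congr (_ + _).
by apply: eq_bigr => i _; rewrite addnC pg.
Qed.

Lemma avg_periodic t d s g : periodic t g -> periodic t (avg d s g).
Proof.
by move=> pg a; congr (_ / _); apply: eq_bigr => i _; rewrite addnAC pg.
Qed.

Lemma avg_periodic_step d s g : periodic (d * s) g -> periodic s (avg d s g).
Proof.
move=> pg a; congr (_ / _).
have ph : periodic d (fun i => g (a + i * s)%N).
  by move=> i; rewrite mulnDl addnA pg.
rewrite -(sum_shift 1 ph); apply: eq_bigr => i _.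
by rewrite addn1 mulSn addnA.
Qed.

Lemma avg_comm d s d' s' g : avg d s (avg d' s' g) = avg d' s' (avg d s g).
Proof.
apply: functional_extensionality => a; rewrite /avg -!mulr_suml exchange_big /=.
rewrite mulrAC; congr (_ / _ / _); apply: eq_bigr => i _; apply: eq_bigr => j _.
by rewrite addnAC.
Qed.

Lemma avgB d s g h : avg d s (fun a => g a - h a) = (fun a => avg d s g a - avg d s h a).
Proof. by apply: functional_extensionality => a; rewrite /avg sumrB mulrBl. Qed.

(** Shifting by a multiple of [s] fixes [h] and permutes a full period of length [N], so each of the
    [d] shifts contributes the same sum. *)
Lemma sum_avg_mul N d s g h : (0 < d)%N -> periodic N g -> periodic N h ->
  periodic s h -> \sum_(a < N) avg d s g a * h a = \sum_(a < N) g a * h a.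
Proof.
move=> d_gt0 pg ph psh.
transitivity (\sum_(i < d) (\sum_(a < N) g a * h a) / d%:R); last first.
  rewrite sumr_const card_ord -mulrnAr -[_^-1 *+ _]mulr_natr mulVf ?mulr1 //.
  by rewrite pnatr_eq0 -lt0n.
under eq_bigr do rewrite /avg mulr_suml mulr_suml.
rewrite exchange_big /=; apply: eq_bigr => i _; rewrite mulr_suml.
pose w a := g a * h a / d%:R.
have pw : periodic N w by move=> a; rewrite /w pg ph.
rewrite -[RHS](sum_shift (i * s) pw); apply: eq_bigr => a _.
by rewrite /w (periodicM i psh) mulrAC.
Qed.

Lemma sum_avg N d s g : (0 < d)%N -> periodic N g ->
  \sum_(a < N) avg d s g a = \sum_(a < N) g a.
Proof.
move=> d_gt0 pg; have := @sum_avg_mul N d s g (fun=> 1) d_gt0 pg.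
by under eq_bigr do rewrite mulr1; under [in RHS]eq_bigr do rewrite mulr1; apply.
Qed.

Lemma energy_ge0 N g : 0 <= energy N g.
Proof. by apply: sumr_ge0 => a _; apply: sqr_ge0. Qed.

(** Pythagoras: [sum_avg_mul] with [h] the average itself makes [g - avg d s g] orthogonal to
    [avg d s g]. *)
Lemma energy_avg N d s g : (0 < d)%N -> N = (d * s)%N -> periodic N g ->
  energy N g = energy N (avg d s g) + energy N (fun a => g a - avg d s g a).
Proof.
move=> d_gt0 defN pg.
have pa := avg_periodic d s pg.
have ps : periodic s (avg d s g) by apply: avg_periodic_step; rewrite -defN.
have := sum_avg_mul d_gt0 pg pa ps; rewrite /energy -big_split /=.
set X := \sum_(a < N) _ => E.
have -> : \sum_(a < N) (avg d s g a ^+ 2 + (g a - avg d s g a) ^+ 2) =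
  \sum_(a < N) g a ^+ 2 + (X + X) - (\sum_(a < N) g a * avg d s g a) *+ 2.
  rewrite -!big_split /= -sumrMnl -sumrB; apply: eq_bigr => a _.
  by rewrite mulr2n; ring.
by rewrite E mulr2n addrK.
Qed.

Lemma energy_sub_avg_le N d s g : (0 < d)%N -> N = (d * s)%N -> periodic N g ->
  energy N (fun a => g a - avg d s g a) <= energy N g.
Proof. by move=> d0 dN pg; rewrite [leRHS](energy_avg d0 dN pg) lerDr energy_ge0. Qed.

Lemma variation_avg N d s g : (0 < d)%N -> periodic N g ->
  variation N (avg d s g) <= variation N g.
Proof.
move=> d_gt0 pg; pose v a := `|g a.+1 - g a|.
have pv : periodic N v by move=> a; rewrite /v -addSn !pg.
have -> : variation N g = \sum_(a < N) avg d s v a by rewrite sum_avg.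
apply: ler_sum => a _.
rewrite /avg -mulrBl normrM [`|_^-1|]ger0_norm ?invr_ge0 ?ler0n //.
apply: ler_wpM2r; first by rewrite invr_ge0 ler0n.
by rewrite -sumrB; apply: ler_norm_sum.
Qed.

(** By Bezout, [s] is the difference of a multiple of [d * s] and a multiple of [p * s]. *)
Lemma periodic_coprime d p s g : coprime d p ->
  periodic (d * s) g -> periodic (p * s) g -> periodic s g.
Proof.
move=> cop pd pp a; case: (posnP d) cop => [->|d_gt0] cop.
  by move: cop pp; rewrite /coprime gcd0n => /eqP->; rewrite mul1n; apply.
case: (egcdnP p d_gt0) => km kn E _; move: E; rewrite (eqP cop) => E.
rewrite -[RHS](periodicM km pd) -(periodicM kn pp).
by congr g; rewrite !mulnA E mulnDl mul1n; lia.
Qed.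

Lemma dist_le_variation r g a j : periodic r g -> (j <= r)%N ->
  `|g (a + j)%N - g a| <= variation r g.
Proof.
move=> pg le_jr; pose v i := `|g i.+1 - g i|.
have pv : periodic r v by move=> i; rewrite /v -addSn !pg.
have -> : variation r g = \sum_(0 <= i < r) v (i + a)%N by rewrite big_mkord sum_shift.
rewrite (big_cat_nat (n := j)) //=; apply: (@le_trans _ _ (\sum_(0 <= i < j) v (i + a)%N)).
  by rewrite addnC -(telescope_sumr (fun i => g (i + a)%N) (leq0n j)); apply: ler_norm_sum.
by rewrite lerDl; apply: sumr_ge0 => i _; apply: normr_ge0.
Qed.

(** Since [u] has mean zero, [u a] is the mean of the differences [u a - u (a + i)] over one period.
    Each is at most the variation over that period, which is a [d]-th of the variation over
    [d * r]. *)
Lemma norm_le_variation d r u a : (0 < d)%N -> (0 < r)%N -> periodic r u ->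
  \sum_(i < d * r) u i = 0 -> `|u a| <= variation (d * r) u / d%:R.
Proof.
move=> d_gt0 r_gt0 pu su0.
have dF : 0 < d%:R :> F by rewrite ltr0n.
have rF : 0 < r%:R :> F by rewrite ltr0n.
have pv : periodic r (fun i => `|u i.+1 - u i|) by move=> i; rewrite -addSn !pu.
have -> : variation (d * r) u = variation r u * d%:R.
  by rewrite /variation (sum_periodic_mul d pv) mulr_natr.
rewrite mulfK ?gt_eqF //; move: su0; rewrite sum_periodic_mul //.
move/eqP; rewrite mulrn_eq0 eqn0Ngt d_gt0 /= -(sum_shift a pu) => /eqP su0.
have E : u a * r%:R = - \sum_(i < r) (u (a + i)%N - u a).
  under eq_bigr do rewrite addnC.
  by rewrite sumrB su0 sumr_const card_ord sub0r opprK mulr_natr.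
rewrite -(ler_pM2r rF).
have -> : `|u a| * r%:R = `|u a * r%:R| by rewrite normrM (gtr0_norm rF).
rewrite E normrN; apply: le_trans (ler_norm_sum _ _ _) _.
rewrite mulr_natr -[X in _ *+ X](card_ord r) -sumr_const; apply: ler_sum => i _.
by apply: dist_le_variation => //; apply: ltnW.
Qed.

(* The sum of [energy N (avg p1 (.. (avg pk g)))] over the sublists
   [p1; ..; pk] of [l] of length [k]. *)
Fixpoint subset_energy (N k : nat) (l : seq nat) g {struct l} : F :=
  match k, l with
  | 0, _ => energy N g
  | k'.+1, [::] => 0
  | k'.+1, p :: l' =>
      subset_energy N k l' g + subset_energy N k' l' (avg p (N %/ p) g)
  end.

Lemma subset_energy0 N l g : subset_energy N 0 l g = energy N g.
Proof. by case: l. Qed.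

(** The complementary projection commutes with all the other averages and does not increase
    energy. *)
Lemma subset_energy_sub_avg N k l p g : (0 < p)%N -> (p %| N)%N ->
  all (fun q => (0 < q)%N) l -> periodic N g ->
  subset_energy N k l (fun a => g a - avg p (N %/ p) g a) <= subset_energy N k l g.
Proof.
move=> p_gt0 pN; have defN : N = (p * (N %/ p))%N by rewrite mulnC divnK.
elim: l k g => [|q l IHl] [|k] g //= gl pg; try exact: energy_sub_avg_le.
case/andP: gl => q_gt0 gl; apply: lerD; first exact: IHl.
by rewrite avgB avg_comm; apply: IHl => //; apply: avg_periodic.
Qed.

(* The averages are commuting orthogonal projections, so this is the scalar
   inequality [s <= k + 'C(s, k.+1)], where [s] counts the projections that fix
   a joint eigenvector. *)
Lemma sum_energy_avg N k l g : all (fun q => (0 < q)%N && (q %| N)%N) l ->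
  periodic N g ->
  \sum_(p <- l) energy N (avg p (N %/ p) g) <=
    k%:R * energy N g + subset_energy N k.+1 l g.
Proof.
elim: l k g => [|p l IHl] k g /=.
  by rewrite big_nil addr0 mulr_ge0 ?ler0n ?energy_ge0.
case/andP=> /andP[p_gt0 pN] gl pg; rewrite big_cons.
have defN : N = (p * (N %/ p))%N by rewrite mulnC divnK.
have gl0 : all (fun q => (0 < q)%N) l by apply: sub_all gl => q /andP[].
set P := avg p (N %/ p).
have pP : periodic N (P g) by apply: avg_periodic.
have pQ : periodic N (fun a => g a - P g a) by move=> a; rewrite pg pP.
case: k => [|k].
  rewrite mul0r add0r subset_energy0 addrC; apply: lerD => //.
  by apply: le_trans (IHl 0%N g gl pg) _; rewrite mul0r add0r.
(* Every energy splits along the image and the kernel of [P]. On the image [p] already counts once,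
   so induction is used there with [k], and on the kernel with [k.+1]. *)
have -> : \sum_(q <- l) energy N (avg q (N %/ q) g) =
    \sum_(q <- l) energy N (avg q (N %/ q) (P g)) +
    \sum_(q <- l) energy N (avg q (N %/ q) (fun a => g a - P g a)).
  rewrite -big_split /=; apply: eq_bigr => q _.
  by rewrite avgB avg_comm; apply: energy_avg => //; apply: avg_periodic.
have H1 := IHl k _ gl pP.
have H2 := IHl k.+1 _ gl pQ.
have H3 := subset_energy_sub_avg k.+2 p_gt0 pN gl0 pg.
have H4 := energy_avg p_gt0 defN pg.
rewrite -/P in H3 H4; rewrite H4 -natr1.
set x := energy N (P g) in H1 H2 *; set y := energy N _ in H1 H2 *.
rewrite -natr1 in H2.
move: H1 H2 H3; set a := \sum_(q <- l) _; set b := \sum_(q <- l) _.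
set c := subset_energy _ _ _ _; set d := subset_energy _ _ _ _; set e := subset_energy _ _ _ _.
lra.
Qed.

Lemma energy_le_variation N d u V : (0 < N)%N -> (0 < d)%N -> (d %| N)%N ->
  periodic (N %/ d) u -> \sum_(i < N) u i = 0 -> variation N u <= V ->
  energy N u <= N%:R * (V / d%:R) ^+ 2.
Proof.
move=> N_gt0 d_gt0 dN pu su0 uV.
have defN : N = (d * (N %/ d))%N by rewrite mulnC divnK.
rewrite -[X in X%:R]card_ord mulr_natl -sumr_const /energy; apply: ler_sum => a _.
rewrite -real_normK ?num_real // lerXn2r ?nnegrE ?normr_ge0 //.
  apply: divr_ge0; rewrite ?ler0n // (le_trans _ uV) //.
  by apply: sumr_ge0 => i _; apply: normr_ge0.
apply: le_trans (_ : variation N u / d%:R <= _); last first.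
  by rewrite ler_wpM2r // invr_ge0 ler0n.
have := @norm_le_variation d (N %/ d) u a d_gt0; rewrite -defN; apply=> //.
by rewrite divn_gt0 // dvdn_leq.
Qed.

(* An average over [q] shifts by [N / q] has period [N / q]; having mean zero, it
   is bounded by its variation over one period, a [q]-th of the total. *)
Lemma subset_energy_le N P V k l d u : (0 < N)%N -> (0 < P)%N -> (0 < d)%N ->
  (d %| N)%N -> all (fun q => [&& P <= q, q %| N & coprime d q]%N) l ->
  pairwise coprime l -> periodic (N %/ d) u -> periodic N u ->
  \sum_(i < N) u i = 0 -> variation N u <= V ->
  subset_energy N k l u <=
    (size l ^ k)%:R * (N%:R * (V / (d * P ^ k)%:R) ^+ 2).
Proof.
(* The induction varies [d], which collects the product of the primes already averaged over, and
   [u], which is the function averaged so far. *)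
move=> N_gt0 P_gt0; elim: l k d u => [|p l IHl] [|k] d u d_gt0 dN gl cl pdu pu su0 uV /=.
- by rewrite expn0 muln1 mul1r; apply: energy_le_variation.
- by rewrite exp0n // mul0r.
- by rewrite expn0 muln1 mul1r; apply: energy_le_variation.
move: gl cl => /= /andP[/and3P[Pp pN dp] gl] /andP[cpl cl].
have p_gt0 : (0 < p)%N by apply: leq_trans Pp.
have V_ge0 : 0 <= V by apply: le_trans uV; apply: sumr_ge0 => i _; apply: normr_ge0.
have dpN : (d * p %| N)%N by rewrite Gauss_dvd // dN.
set v := avg p (N %/ p) u.
have pv : periodic N v by apply: avg_periodic.
have pv' : periodic (N %/ (d * p)) v.
  apply: (periodic_coprime dp).
    have -> : (d * (N %/ (d * p)) = N %/ p)%N.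
      case/dvdnP: dpN => q ->; rewrite mulnK ?muln_gt0 ?d_gt0 //.
      by rewrite mulnA mulnK // mulnC.
    by apply: avg_periodic_step; rewrite mulnC divnK.
  have -> : (p * (N %/ (d * p)) = N %/ d)%N.
    case/dvdnP: dpN => q ->; rewrite mulnK ?muln_gt0 ?d_gt0 //.
    by rewrite [(d * p)%N]mulnC mulnA mulnK // mulnC.
  exact: avg_periodic.
have H1 := IHl k.+1 d u d_gt0 dN.
have H2 := IHl k (d * p)%N v.
set X := N%:R * (V / (d * P ^ k.+1)%:R) ^+ 2 in H1 *.
(* Sublists without [p] and with [p] are counted separately; powers of the size replace binomial
   coefficients, as [n^(k+1) + n^k <= (n+1)^(k+1)]. *)
apply: (@le_trans _ _ ((size l ^ k.+1)%:R * X + (size l ^ k)%:R * X)); last first.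
  rewrite -mulrDl; apply: ler_wpM2r.
    by rewrite mulr_ge0 ?ler0n ?sqr_ge0.
  rewrite -natrD ler_nat; rewrite !expnS.
  have h : (size l ^ k <= (size l).+1 ^ k)%N by case: (k) => // k'; rewrite leq_exp2r.
  nia.
apply: lerD.
  apply: H1 => //; by apply: sub_all gl => q /and3P[-> -> ->].
apply: le_trans (H2 _ dpN _ cl pv' pv _ _) _.
- by rewrite muln_gt0 d_gt0.
- apply/allP => q ql; have /and3P[-> -> dq] := allP gl q ql.
  by rewrite coprimeMl dq (allP cpl).
- by rewrite sum_avg.
- by apply: le_trans uV; apply: variation_avg.
apply: ler_wpM2l; first exact: ler0n.
apply: ler_wpM2l; first exact: ler0n.
rewrite lerXn2r ?nnegrE ?divr_ge0 ?ler0n //; apply: ler_wpM2l => //.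
rewrite lef_pV2 ?posrE ?ltr0n ?muln_gt0 ?expn_gt0 ?P_gt0 ?d_gt0 ?p_gt0 //.
by rewrite ler_nat expnS -mulnA !leq_mul.
Qed.

End Averages.

(** * Grid points missed by every dilation *)

Implicit Types (f : nat -> bool) (ps : seq nat).

Definition changes (N : nat) (f : nat -> bool) : nat := \sum_(a < N) (f a.+1 != f a).

Definition missing (f : nat -> bool) (ps : seq nat) (a : nat) : bool :=
  all (fun p => ~~ f (p * a)%N) ps.

Definition missing_count (N : nat) (f : nat -> bool) (ps : seq nat) : nat :=
  \sum_(a < N) missing f ps a.

Lemma change_le_sum (f : nat -> bool) a n :
  ((f (a + n) != f a) <= \sum_(i < n) (f (a + i).+1 != f (a + i)))%N.
Proof.
elim: n => [|n IHn]; first by rewrite addn0 eqxx.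
rewrite big_ord_recr /= addnS; move: IHn; set s := (\sum_(i < n) _)%N.
by case: (f a); case: (f (a + n)%N); case: (f (a + n).+1); rewrite //=; lia.
Qed.

Lemma sum_blocks (v : nat -> nat) N p :
  (\sum_(a < N) \sum_(i < p) v (p * a + i) = \sum_(b < N * p) v b)%N.
Proof.
elim: N => [|N IHN]; first by rewrite mul0n !big_ord0.
rewrite big_ord_recr IHN mulSn addnC big_split_ord /=; congr (_ + _)%N.
by apply: eq_bigr => i _; rewrite mulnC.
Qed.

Lemma sum_periodic_muln n d (v : nat -> nat) : periodic n v ->
  (\sum_(i < d * n) v i = d * \sum_(i < n) v i)%N.
Proof.
move=> pv; elim: d => [|d IHd]; first by rewrite !mul0n big_ord0.
rewrite !mulSn big_split_ord -IHd /=; congr (_ + _)%N.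
by apply: eq_bigr => i _; rewrite addnC pv.
Qed.

(** A change from [a] to [a + 1] forces a change of [f] somewhere between [p * a] and [p * a + p],
    and these blocks tile [p] periods of [f]. *)
Lemma changes_dilate N p (f : nat -> bool) : periodic N f ->
  (changes N (fun a => f (p * a)) <= p * changes N f)%N.
Proof.
move=> pf; pose v b : nat := (f b.+1 != f b).
have pv : periodic N v by move=> b; rewrite /v -addSn !pf.
have -> : (p * changes N f = \sum_(b < N * p) v b)%N.
  by rewrite [(N * p)%N]mulnC sum_periodic_muln.
rewrite -sum_blocks; apply: leq_sum => a _; rewrite mulnS addnC.
by apply: leq_trans (change_le_sum f (p * a) p) _; apply: leq_sum.
Qed.

Lemma missing_change f ps a :
  ((missing f ps a.+1 != missing f ps a) <=
   \sum_(p <- ps) (f (p * a.+1) != f (p * a)))%N.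
Proof.
elim: ps => [|p ps IHps]; first by rewrite big_nil.
rewrite big_cons /= -/(missing f ps a) -/(missing f ps a.+1).
move: IHps; set s := (\sum_(q <- ps) _)%N.
by case: (f (p * a)%N); case: (f (p * a.+1)%N); case: (missing f ps a);
  case: (missing f ps a.+1); rewrite //=; lia.
Qed.

Lemma changes_missing N f ps : periodic N f ->
  (changes N (missing f ps) <= changes N f * \sum_(p <- ps) p)%N.
Proof.
move=> pf; rewrite big_distrr /=.
apply: (@leq_trans (\sum_(a < N) \sum_(p <- ps) (f (p * a.+1) != f (p * a)))).
  by apply: leq_sum => a _; apply: missing_change.
rewrite exchange_big /=; apply: leq_sum => p _; rewrite mulnC.
exact: changes_dilate.
Qed.

Lemma missing_periodic N f ps : periodic N f -> periodic N (missing f ps).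
Proof.
by move=> pf a; apply: eq_all => p; rewrite mulnDr (periodicM p pf).
Qed.

Section Missing.
Context {F : realFieldType}.

Definition centred_missing N f ps : nat -> F := fun a =>
  (missing f ps a)%:R - (missing_count N f ps)%:R / N%:R.

Lemma sum_centred_missing N f ps : (0 < N)%N -> \sum_(a < N) centred_missing N f ps a = 0.
Proof.
move=> N_gt0; rewrite sumrB sumr_const card_ord -natr_sum -[_ / _ *+ _]mulr_natr.
by rewrite divfK ?subrr // pnatr_eq0 -lt0n.
Qed.

(** With [c] missing points the energy is exactly [c (1 - c / N)], the variance of an indicator. *)
Lemma energy_centred_missing N f ps : (0 < N)%N ->
  energy N (centred_missing N f ps) <= (missing_count N f ps)%:R.
Proof.
move=> N_gt0; have sE := sum_centred_missing f ps N_gt0; set c := (missing_count N f ps)%:R in sE *.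
have -> : energy N (centred_missing N f ps) = \sum_(a < N) (missing f ps a)%:R *
    (1 - c / N%:R) - c / N%:R * \sum_(a < N) centred_missing N f ps a.
  rewrite mulr_sumr -sumrB; apply: eq_bigr => a _; rewrite /centred_missing -/c.
  by case: (missing f ps a); rewrite /=; ring.
rewrite sE mulr0 subr0 -mulr_suml -natr_sum -/(missing_count N f ps) -/c ler_piMr ?ler0n //.
by rewrite gerBl divr_ge0 ?ler0n.
Qed.

Lemma variation_centred_missing N f ps :
  variation N (centred_missing N f ps) = (changes N (missing f ps))%:R.
Proof.
rewrite /changes natr_sum; apply: eq_bigr => a _; rewrite /centred_missing opprB addrA subrK.
by case: (missing f ps a); case: (missing f ps a.+1);
  rewrite ?subrr ?subr0 ?sub0r ?normrN ?normr0 ?normr1.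
Qed.

(* Testing the projection of the centred indicator of the missing set against
   the hits of [p], from which the missing set is disjoint. *)
Lemma hits_le_energy N f ps p M : (0 < N)%N -> periodic N f -> p \in ps ->
  (0 < p)%N -> (p %| N)%N -> (M <= \sum_(a < N) f (p * a)%N)%N ->
  ((missing_count N f ps)%:R / N%:R) ^+ 2 * M%:R <=
    energy N (avg p (N %/ p) (centred_missing N f ps)).
Proof.
move=> N_gt0 pf pps p_gt0 pN leM; set c := _ / _.
pose w a : F := (f (p * a)%N)%:R.
have pe : periodic N (centred_missing N f ps).
  by move=> a; rewrite /centred_missing (missing_periodic ps pf).
have pw : periodic N w by move=> a; rewrite /w mulnDr (periodicM p pf).
have pw' : periodic (N %/ p) w by move=> a; rewrite /w mulnDr [(p * (N %/ p))%N]mulnC divnK // pf.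
set e := avg _ _ _.
have E : \sum_(a < N) e a * w a = - c * (\sum_(a < N) f (p * a)%N)%:R.
  rewrite (sum_avg_mul p_gt0 pe pw pw') natr_sum mulr_sumr.
  apply: eq_bigr => a _; rewrite /centred_missing -/c /w.
  case: (boolP (missing f ps a)) => [/allP/(_ p pps)/negbTE->|_].
    by rewrite !mulr0.
  by rewrite sub0r.
set Mp := (\sum_(a < N) f (p * a)%N)%N in leM E.
(* Cauchy-Schwarz as a completed square: the cross term is [-2 c^2 Mp] and the last term [c^2 Mp],
   which leaves [energy N e >= c^2 Mp]. *)
have : 0 <= \sum_(a < N) (e a + c * w a) ^+ 2.
  by apply: sumr_ge0 => a _; apply: sqr_ge0.
have -> : \sum_(a < N) (e a + c * w a) ^+ 2 =
    energy N e + c * 2 * (\sum_(a < N) e a * w a) + c ^+ 2 * Mp%:R.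
  rewrite /energy !mulr_sumr /Mp natr_sum mulr_sumr -!big_split /=.
  by apply: eq_bigr => a _; rewrite /w; case: (f (p * a)%N); rewrite /=; ring.
rewrite E => H; have : c ^+ 2 * M%:R <= c ^+ 2 * Mp%:R.
  by rewrite ler_wpM2l ?sqr_ge0 // ler_nat.
by move: H; lra.
Qed.

(** The sum of the projected energies is bounded below by [hits_le_energy] for each prime, and above
    by [sum_energy_avg], whose remainder [subset_energy_le] controls. *)
Lemma missing_bound_field N f ps P k M : (0 < N)%N -> (0 < P)%N -> periodic N f ->
  uniq ps -> all (fun p => [&& prime p, P <= p & p %| N])%N ps ->
  {in ps, forall p, M <= \sum_(a < N) f (p * a)}%N ->
  (size ps)%:R * (((missing_count N f ps)%:R / N%:R) ^+ 2 * M%:R) <=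
   k%:R * (missing_count N f ps)%:R +
   (size ps ^ k.+1)%:R *
     (N%:R * ((changes N f * \sum_(p <- ps) p)%:R / (P ^ k.+1)%:R) ^+ 2) :> F.
Proof.
move=> N_gt0 P_gt0 pf ups gps hM.
have gp p : p \in ps -> [&& prime p, P <= p & p %| N]%N by move/(allP gps).
have pe : periodic N (centred_missing N f ps).
  by move=> a; rewrite /centred_missing (missing_periodic ps pf).
apply: (@le_trans _ _ (\sum_(p <- ps) energy N (avg p (N %/ p) (centred_missing N f ps)))).
  rewrite -sum1_size natr_sum mulr_suml big_seq [leRHS]big_seq.
  apply: ler_sum => p pps; rewrite mul1r.
  have /and3P[pr_p _ pN] := gp p pps.
  by apply: hits_le_energy => //; [apply: prime_gt0 | apply: hM].
apply: le_trans (sum_energy_avg k _ pe) _.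
  by apply/allP => p /gp/and3P[/prime_gt0-> _ ->].
apply: lerD; first by rewrite ler_wpM2l ?ler0n // energy_centred_missing.
have := @subset_energy_le F N P (changes N f * \sum_(p <- ps) p)%:R k.+1 ps 1
  (centred_missing N f ps).
rewrite mul1n; apply=> //.
- by apply/allP => p /gp/and3P[_ -> ->]; rewrite coprime1n.
- have: {in ps &, forall p q, p != q -> coprime p q}.
    move=> p q /gp/and3P[pr_p _ _] /gp/and3P[pr_q _ _] npq.
    by rewrite prime_coprime // dvdn_prime2.
  elim: (ps) ups => //= p l IHl /andP[pl ul] cop; rewrite IHl //; last first.
    by move=> x y xl yl; apply: cop; rewrite inE ?xl ?yl orbT.
  rewrite andbT; apply/allP => q ql; apply: cop; rewrite ?inE ?eqxx ?ql ?orbT //.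
  by apply: contraNneq pl => ->.
- by rewrite divn1.
- exact: sum_centred_missing.
- by rewrite variation_centred_missing ler_nat changes_missing.
Qed.

End Missing.

(** The rational instance with denominators cleared; as an inequality between natural numbers it can
    be carried over to the reals [R]. *)
Lemma missing_bound N f ps P k M : (0 < N)%N -> (0 < P)%N -> periodic N f ->
  uniq ps -> all (fun p => [&& prime p, P <= p & p %| N])%N ps ->
  {in ps, forall p, M <= \sum_(a < N) f (p * a)}%N ->
  (size ps * missing_count N f ps ^ 2 * M * (P ^ k.+1) ^ 2 <=
   k * missing_count N f ps * N ^ 2 * (P ^ k.+1) ^ 2 +
   size ps ^ k.+1 * N ^ 3 * (changes N f * \sum_(p <- ps) p) ^ 2)%N.
Proof.
move=> N_gt0 P_gt0 pf ups gps hM.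
have := @missing_bound_field rat N f ps P k M N_gt0 P_gt0 pf ups gps hM.
set E := missing_count _ _ _; set W := (changes N f * _)%N.
have PF : 0 < (P ^ k.+1)%:R :> rat by rewrite ltr0n expn_gt0 P_gt0.
have NF : 0 < N%:R :> rat by rewrite ltr0n.
move=> H; rewrite -(ler_nat rat).
have K : 0 <= (N%:R ^+ 2 * (P ^ k.+1)%:R ^+ 2 : rat) by rewrite mulr_ge0 ?sqr_ge0.
have := ler_wpM2r K H.
rewrite !natrD !natrM !natrX -!natrX.
have N0 : N%:R != 0 :> rat by rewrite gt_eqF.
have P0 : (P ^ k.+1)%:R != 0 :> rat by rewrite gt_eqF.
rewrite !natrX in P0 *; congr (_ <= _).
- by field.
- by field; rewrite P0.
Qed.

End Grid.

(** * Unions of real intervals sampled on a grid *)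

Module Covers.

Import ZArith Reals Lra ClassicalEpsilon all_boot zify.zify Defs.
Import Primes Grid.
Set Implicit Arguments.
Unset Strict Implicit.
Unset Printing Implicit Defensive.
Local Open Scope R_scope.

Lemma nat_floor x : 0 <= x -> exists n : nat, INR n <= x < INR n + 1.
Proof.
move=> x_ge0; have [h1 h2] := base_Int_part x.
have z_ge0 : (0 <= Int_part x)%Z.
  by apply/Z.lt_succ_r; apply: lt_IZR; rewrite succ_IZR; lra.
exists (Z.to_nat (Int_part x)); rewrite INR_IZR_INZ Z2Nat.id //; lra.
Qed.

Lemma frac_part_addn (q : nat) y : 0 <= y < 1 -> frac_part (INR q + y) = y.
Proof.
move=> y01; rewrite /frac_part -(@Int_part_spec _ (Z.of_nat q)) -?INR_IZR_INZ; lra.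
Qed.

Lemma leq_INR m n : (m <= n)%N -> INR m <= INR n.
Proof. by move=> /leP; apply: le_INR. Qed.

Lemma ltn_INR m n : (m < n)%N -> INR m < INR n.
Proof. by move=> /ltP; apply: lt_INR. Qed.

Lemma INR_ltn m n : INR m < INR n -> (m < n)%N.
Proof. by move=> h; apply/ltP; apply: INR_lt. Qed.

Definition Rltb x y : bool := if Rlt_dec x y then true else false.
Definition Rleb x y : bool := if Rle_dec x y then true else false.

Lemma RltbP x y : reflect (x < y) (Rltb x y).
Proof. by rewrite /Rltb; case: Rlt_dec => h; constructor. Qed.

Lemma RlebP x y : reflect (x <= y) (Rleb x y).
Proof. by rewrite /Rleb; case: Rle_dec => h; constructor. Qed.

(* The upper end of each interval is moved down by [H / N], so that a cell of
   the [N]-grid whose left end is hit after dilation by some [p <= H] is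
   mapped entirely into the interval. *)
Definition hit (N H : nat) (I : interval) (b : nat) : bool :=
  Rltb (lo I * INR N) (INR b) && Rleb (INR b + INR H) (hi I * INR N).

(** The residue [b %% N] plays the part of the fractional part of [b / N]. *)
Definition grid_hit (N H : nat) (l : seq interval) (b : nat) : bool :=
  has (fun I => hit N H I (b %% N)) l.

Lemma grid_hit_periodic N H l : periodic N (grid_hit N H l).
Proof. by move=> a; rewrite /grid_hit modnDr. Qed.

Lemma changes_and N f g :
  (changes N (fun a => f a && g a) <= changes N f + changes N g)%N.
Proof.
rewrite /changes -big_split /=; apply: leq_sum => a _.
by case: (f a); case: (g a); case: (f a.+1); case: (g a.+1).
Qed.

Lemma changes_or N f g :
  (changes N (fun a => f a || g a) <= changes N f + changes N g)%N.
Proof.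
rewrite /changes -big_split /=; apply: leq_sum => a _.
by case: (f a); case: (g a); case: (f a.+1); case: (g a.+1).
Qed.

(** There is at most one jump inside the period and at most one where the residue wraps around to
    0. *)
Lemma changes_monotone N (g : nat -> bool) :
  (forall r s, (r <= s)%N -> g r -> g s) -> (changes N (fun a => g (a %% N)) <= 2)%N.
Proof.
case: N => [|n] mono; first by rewrite /changes big_ord0.
rewrite /changes big_ord_recr /=.
have -> : (\sum_(i < n) (g (i.+1 %% n.+1) != g (i %% n.+1)) =
           \sum_(i < n) (g i.+1 != g i))%N.
  by apply: eq_bigr => i _; rewrite !modn_small // ltnS // ltnW.
have <- : (g n - g 0 = \sum_(i < n) (g i.+1 != g i))%N; last first.
  by case: (g n); case: (g 0%N); case: (_ != _).
elim: (n) => [|k IHk]; first by rewrite big_ord0 subnn.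
rewrite big_ord_recr /= -IHk.
have := mono 0%N k (leq0n k); have := mono k k.+1 (leqnSn k).
by case: (g 0%N); case: (g k); case: (g k.+1) => //= h1 h2;
  first [have := h1 isT | have := h2 isT].
Qed.

Lemma changes_negb N f : changes N (fun a => ~~ f a) = changes N f.
Proof. by apply: eq_bigr => a _; case: (f a); case: (f a.+1). Qed.

Lemma changes_grid_hit N H l : (changes N (grid_hit N H l) <= 4 * size l)%N.
Proof.
elim: l => [|I l IHl].
  by rewrite /changes big1.
apply: leq_trans (changes_or _ _ _) _; rewrite mulnS; apply: leq_add => //.
apply: leq_trans (changes_and _ _ _) _; apply: (@leq_add _ _ 2 2).
  apply: (@changes_monotone N (fun b => Rltb (lo I * INR N) (INR b))) => r s /leq_INR rs.
  by move/RltbP => h; apply/RltbP; lra.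
rewrite -changes_negb.
apply: (@changes_monotone N (fun b => ~~ Rleb (INR b + INR H) (hi I * INR N))) => r s /leq_INR rs.
by apply: contraNN => /RlebP h; apply/RlebP; lra.
Qed.

Lemma count_nat_between n u v : 0 <= u -> v < INR n ->
  v - u - 1 <= INR (\sum_(a < n) (Rltb u (INR a) && Rleb (INR a) v))%N.
Proof.
move=> u_ge0 v_lt; case: (Rle_lt_dec v u) => [vu|uv].
  by have := pos_INR (\sum_(a < n) (Rltb u (INR a) && Rleb (INR a) v))%N; lra.
have [i [i1 i2]] := nat_floor u_ge0.
have [|j [j1 j2]] := @nat_floor v; first lra.
have lt_jn : (j < n)%N by apply: INR_ltn; lra.
have le_ij : (i <= j)%N.
  by rewrite -ltnS; apply: INR_ltn; rewrite S_INR; lra.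
have : (j - i <= \sum_(a < n) (Rltb u (INR a) && Rleb (INR a) v))%N.
  rewrite -(big_mkord predT (fun a => nat_of_bool (Rltb u (INR a) && Rleb (INR a) v))).
  rewrite (@big_cat_nat _ _ _ j.+1) //= (@big_cat_nat _ _ _ i.+1) //=.
  apply: (@leq_trans (\sum_(i.+1 <= a < j.+1) (Rltb u (INR a) && Rleb (INR a) v))); last lia.
  rewrite -(subSS i) -[X in (X <= _)%N]muln1 -sum_nat_const_nat.
  rewrite big_nat_cond [X in (_ <= X)%N]big_nat_cond.
  apply: leq_sum => a /andP[/andP[/leq_INR h1 h2] _].
  rewrite ltnS in h2; have h3 := leq_INR h2; rewrite S_INR in h1.
  have -> : Rltb u (INR a) by apply/RltbP; lra.
  by have -> : Rleb (INR a) v by apply/RlebP; lra.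
move/leq_INR; rewrite minus_INR; last exact/leP.
lra.
Qed.

(** If an end stuck out of [[0, 1]], the midpoint of the protruding piece would be a point of [I]
    outside [[0, 1)], whichever ends are closed. *)
Lemma interval_bounds I : lo I < hi I ->
  (forall x, in_interval I x -> 0 <= x < 1) -> 0 <= lo I /\ hi I <= 1.
Proof.
move=> lt_I sub; split; apply: Rnot_lt_le => h.
  have := sub ((lo I + Rmin (hi I) 0) / 2); rewrite /in_interval.
  have [h1 h2] : Rmin (hi I) 0 <= hi I /\ Rmin (hi I) 0 <= 0.
    by split; [apply: Rmin_l|apply: Rmin_r].
  have h3 : lo I < Rmin (hi I) 0 by apply: Rmin_glb_lt.
  by case: (lo_closed I); case: (hi_closed I) => k; have [] := k _; lra.
have := sub ((hi I + Rmax (lo I) 1) / 2); rewrite /in_interval.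
have [h1 h2] : lo I <= Rmax (lo I) 1 /\ 1 <= Rmax (lo I) 1.
  by split; [apply: Rmax_l|apply: Rmax_r].
have h3 : Rmax (lo I) 1 < hi I by apply: Rmax_lub_lt.
by case: (lo_closed I); case: (hi_closed I) => k; have [] := k _; lra.
Qed.

Lemma hit_in_interval N H I b y : (0 < N)%N -> hit N H I b ->
  INR b <= y * INR N < INR b + INR H -> in_interval I y.
Proof.
move=> N_gt0 /andP[/RltbP h1 /RlebP h2] [h3 h4].
have NF : 0 < INR N by apply: (@ltn_INR 0).
have h5 : lo I < y by apply: (Rmult_lt_reg_r (INR N)); lra.
have h6 : y < hi I by apply: (Rmult_lt_reg_r (INR N)); lra.
by rewrite /in_interval; case: (lo_closed I); case: (hi_closed I); lra.
Qed.

Lemma pairwise_disjoint_cons I l : pairwise_disjoint (I :: l) ->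
  pairwise_disjoint l /\ (forall x, in_interval I x -> ~ in_union l x).
Proof.
move=> dis; split=> [i j d x il jl nij|x xI [J [Jl xJ]]].
  by apply: (dis i.+1 j.+1 d x); rewrite /= ?ltnS //; lia.
have [j [jl Ej]] := List.In_nth l J I Jl.
by apply: (dis 0%N j.+1 I x) => //=; rewrite ?Ej //; lia.
Qed.

Lemma has_In (T : Type) (q : pred T) l : has q l -> exists x, List.In x l /\ q x.
Proof.
elim: l => //= y l IHl /orP[qy|/IHl[x [xl qx]]]; first by exists y; split => //; left.
by exists x; split => //; right.
Qed.

(** Dividing by [p], the hits are the integers in [(lo I * n, hi I * n - H / p]]. Counting them
    loses at most [1 + H / p], which after multiplication by [p] is [p + H <= 2 H]. *)
Lemma hits_one p n H I : (0 < p)%N -> (0 < n)%N -> (p <= H)%N ->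
  (forall x, in_interval I x -> 0 <= x < 1) ->
  INR (p * n) * ilength I - 2 * INR H <=
    INR p * INR (\sum_(a < n) hit (p * n) H I (p * a))%N.
Proof.
move=> p_gt0 n_gt0 pH sub.
have pF : 0 < INR p by apply: (@ltn_INR 0).
have nF : 0 < INR n by apply: (@ltn_INR 0).
have pHF := leq_INR pH.
have c_ge0 := pos_INR (\sum_(a < n) hit (p * n) H I (p * a))%N.
rewrite mult_INR /ilength; case: (Rlt_le_dec (lo I) (hi I)) => [lt_I|le_I]; last first.
  rewrite Rmax_left; nra.
have [lo0 hi1] := interval_bounds lt_I sub.
rewrite Rmax_right; last lra.
have := @count_nat_between n (lo I * INR n) (hi I * INR n - INR H / INR p).
have -> : (\sum_(a < n) (Rltb (lo I * INR n) (INR a) &&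
      Rleb (INR a) (hi I * INR n - INR H / INR p)) =
    \sum_(a < n) hit (p * n) H I (p * a))%N.
  apply: eq_bigr => a _; congr (nat_of_bool (_ && _)).
    rewrite !mult_INR; apply/RltbP/RltbP => h; first nra.
    by apply: (Rmult_lt_reg_l (INR p)) => //; lra.
  have hE : INR p * (INR H / INR p) = INR H by field; lra.
  rewrite !mult_INR; apply/RlebP/RlebP => h; first nra.
  by apply: (Rmult_le_reg_l (INR p)) => //; rewrite Rmult_minus_distr_l hE; lra.
set c := INR (\sum_(a < n) _) in c_ge0 *.
have hp : 0 < INR H / INR p by apply: Rdiv_lt_0_compat; lra.
have hE : INR p * (INR H / INR p) = INR H by field; lra.
move=> k; have {k} k : hi I * INR n - INR H / INR p - lo I * INR n - 1 <= c by apply: k; nra.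
nra.
Qed.

Lemma hits_union p n H l : (0 < p)%N -> (0 < n)%N -> (p <= H)%N ->
  pairwise_disjoint l -> (forall x, in_union l x -> 0 <= x < 1) ->
  INR (p * n) * total_length l - 2 * INR (size l) * INR H <=
    INR p * INR (\sum_(a < n) has (fun I => hit (p * n) H I (p * a)) l)%N.
Proof.
move=> p_gt0 n_gt0 pH; elim: l => [|I l IHl] dis sub.
  by rewrite big1 //= Rmult_0_r; lra.
have [disl disI] := pairwise_disjoint_cons dis.
have subI x : in_interval I x -> 0 <= x < 1 by move=> xI; apply: sub; exists I; split => //; left.
have subl x : in_union l x -> 0 <= x < 1.
  by case=> J [Jl xJ]; apply: sub; exists J; split => //; right.
have h1 := hits_one p_gt0 n_gt0 pH subI; have h2 := IHl disl subl.
have H_gt0 : (0 < H)%N by apply: leq_trans pH.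
have -> : (\sum_(a < n) has (fun I => hit (p * n) H I (p * a)) (I :: l) =
  \sum_(a < n) hit (p * n) H I (p * a) +
  \sum_(a < n) has (fun I => hit (p * n) H I (p * a)) l)%N.
  rewrite -big_split /=; apply: eq_bigr => a _.
  case: (boolP (hit _ _ _ _)) => //= hI; case: (boolP (has _ _)) => // /has_In[J [Jl hJ]]; exfalso.
  (* A point hit by two members of the list would put the real number [p * a / (p * n)] in both
     intervals, against disjointness. *)
  have pn_gt0 : (0 < p * n)%N by rewrite muln_gt0 p_gt0.
  have pnF : 0 < INR (p * n) by apply: (@ltn_INR 0).
  have HF : 0 < INR H by apply: (@ltn_INR 0).
  have b : INR (p * a) <= INR (p * a) / INR (p * n) * INR (p * n) < INR (p * a) + INR H.
    have -> : INR (p * a) / INR (p * n) * INR (p * n) = INR (p * a) by field; lra.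
    lra.
  apply: (disI (INR (p * a) / INR (p * n))); first exact: hit_in_interval hI b.
  by exists J; split => //; apply: hit_in_interval hJ b.
rewrite plus_INR [size _]/= S_INR [total_length _]/= -/(total_length l); lra.
Qed.

(** A counting proof: if the length exceeded 1, a fine enough grid would have more hits than points,
    by [hits_union] with [p = H = 1]. *)
Lemma total_length_le1 l : pairwise_disjoint l ->
  (forall x, in_union l x -> 0 <= x < 1) -> total_length l <= 1.
Proof.
move=> dis sub; apply: Rnot_lt_le => gt1; set mu := total_length l in gt1.
have [|n [_ n_gt]] := @nat_floor (2 * INR (size l) / (mu - 1)).
  apply: Rmult_le_pos; last by apply: Rlt_le; apply: Rinv_0_lt_compat; lra.
  by have := pos_INR (size l); lra.
have := @hits_union 1 n.+1 1 l isT isT isT dis sub.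
rewrite mul1n -/mu S_INR [INR 1]/=; set c := (\sum_(a < n.+1) _)%N.
have : (c <= n.+1)%N.
  rewrite -[X in (_ <= X)%N]card_ord -sum1_card; apply: leq_sum => a _.
  by case: (has _ _).
move/leq_INR; rewrite S_INR => h1 h2.
have : 2 * INR (size l) / (mu - 1) * (mu - 1) < (INR n + 1) * (mu - 1).
  by apply: Rmult_lt_compat_r; lra.
have -> : 2 * INR (size l) / (mu - 1) * (mu - 1) = 2 * INR (size l) by field; lra.
lra.
Qed.

Lemma missing_cell N H l ps alpha : (0 < N)%N ->
  (forall x, in_union l x -> 0 <= x < 1) -> 0 <= alpha < 1 ->
  {in ps, forall p, 0 < p <= H}%N ->
  {in ps, forall p, ~ in_union l (frac_part (INR p * alpha))} ->
  exists a, [/\ (a < N)%N, missing (grid_hit N H l) ps a &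
                INR a <= alpha * INR N < INR a + 1].
Proof.
move=> N_gt0 sub a01 psH bad; have NF : 0 < INR N by apply: (@ltn_INR 0).
have [|a [a1 a2]] := @nat_floor (alpha * INR N); first by nra.
exists a; split => //; first by apply: INR_ltn; nra.
apply/allP => p pps; apply/negP => /has_In[I [Il hI]].
have /andP[p_gt0 pH] := psH p pps.
have pF : 0 < INR p by apply: (@ltn_INR 0).
have pHF := leq_INR pH.
set r := (p * a %% N)%N in hI; set q := (p * a %/ N)%N.
have E : INR p * INR a = INR q * INR N + INR r.
  by have := congr1 INR (divn_eq (p * a) N); rewrite plus_INR !mult_INR.
(* On the scale of the grid, [y] exceeds the hit point [r] by [p] times the offset of [alpha] in its
   cell, which is less than [H]; the margin in [hit] absorbs it. *)
pose y := INR p * alpha - INR q.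
have Ey : y * INR N = INR r + INR p * (alpha * INR N - INR a).
  by rewrite /y Rmult_minus_distr_r Rmult_minus_distr_l; lra.
have yI : in_interval I y by apply: hit_in_interval hI _ => //; rewrite Ey; nra.
have yl : in_union l y by exists I.
apply: (bad p pps).
have -> : INR p * alpha = INR q + y by rewrite /y; lra.
by rewrite frac_part_addn //; apply: sub.
Qed.

(** * Covering the bad set at one scale by grid cells *)

Lemma dvdn_prod_mem (s : seq nat) p : p \in s -> (p %| \prod_(q <- s) q)%N.
Proof.
elim: s => //= q s IHs; rewrite inE big_cons => /orP[/eqP->|/IHs].
  exact: dvdn_mulr.
exact: dvdn_mull.
Qed.

(** The map sending [a] to [grid_hit N H l (p * a)] has period [n = N / p], and for [a < n] no
    reduction modulo [N] takes place, so [hits_union] counts one of [p] equal periods. *)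
Lemma grid_hits p N H l : (0 < p)%N -> (0 < N)%N -> (p %| N)%N -> (p <= H)%N ->
  pairwise_disjoint l -> (forall x, in_union l x -> 0 <= x < 1) ->
  INR N * total_length l - 2 * INR (size l) * INR H <=
    INR (\sum_(a < N) grid_hit N H l (p * a))%N.
Proof.
move=> p_gt0 N_gt0 /dvdnP[n defN] pH dis sub.
have n_gt0 : (0 < n)%N by move: N_gt0; rewrite defN muln_gt0 => /andP[].
have := hits_union p_gt0 n_gt0 pH dis sub; rewrite [(p * n)%N]mulnC -defN.
suff -> : (\sum_(a < N) grid_hit N H l (p * a) =
  p * \sum_(a < n) has (fun I => hit N H I (p * a)) l)%N by rewrite mult_INR.
have pv : periodic n (fun a => nat_of_bool (grid_hit N H l (p * a))).
  by move=> a; rewrite /grid_hit mulnDr [(p * n)%N]mulnC -defN modnDr.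
have := sum_periodic_muln p pv; rewrite mulnC -defN => ->.
congr (_ * _)%N; apply: eq_bigr => a _; rewrite /grid_hit modn_small //.
by rewrite defN mulnC ltn_pmul2r // ltn_ord.
Qed.

Lemma pow_INR_expn (a k : nat) : INR (a ^ k)%N = INR a ^ k.
Proof. by elim: k => [|k IHk] //; rewrite expnS mult_INR IHk. Qed.

Lemma cover_of_bad l H P k : (0 < H)%N -> (0 < P)%N -> pairwise_disjoint l ->
  (forall x, in_union l x -> 0 <= x < 1) -> 0 < total_length l ->
  let m := size (primes_in P.+1 H.+1) in
  (m ^ k.+1 * (4 * size l * (m * H)) ^ 2 <= (P ^ k.+1) ^ 2)%N ->
  exists (N : nat) (s : seq nat), [/\ (0 < N)%N,
    INR (size s) ^ 2 * (INR m * total_length l) <= 2 * INR k.+1 * INR N ^ 2 &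
    forall alpha, 0 <= alpha < 1 ->
      (forall h, (0 < h <= H)%N -> ~ in_union l (frac_part (INR h * alpha))) ->
      exists2 a, a \in s & INR a <= alpha * INR N < INR a + 1].
Proof.
move=> H_gt0 P_gt0 dis sub mu_gt0 m le_PW; set mu := total_length l in mu_gt0 *.
set ps := primes_in P.+1 H.+1 in m le_PW *.
have psP p : p \in ps -> [/\ prime p, (P < p)%N & (p <= H)%N].
  by rewrite mem_primes_in => /and3P[].
set Q := (\prod_(p <- ps) p)%N.
have Q_gt0 : (0 < Q)%N.
  by rewrite /Q big_seq; apply: prodn_cond_gt0 => p /psP[/prime_gt0].
set n := size l in le_PW *.
(* The factor [Q] of [N] makes every prime divide [N]; the factor [D.+1] makes the loss [2 n H + 1]
   at most half of [N mu], so that each prime has at least [N mu / 2] hits. *)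
have [|D [_ D_gt]] := @nat_floor ((4 * INR n * INR H + 4) / mu).
  apply: Rmult_le_pos; last by apply: Rlt_le; apply: Rinv_0_lt_compat.
  have : 0 <= INR n * INR H by apply: Rmult_le_pos; apply: pos_INR.
  by lra.
pose N := (D.+1 * Q)%N; have N_gt0 : (0 < N)%N by rewrite muln_gt0.
have NF : 0 < INR N by apply: (@ltn_INR 0).
have Nmu : 4 * INR n * INR H + 4 <= INR N * mu.
  have h1 : (4 * INR n * INR H + 4) / mu * mu < (INR D + 1) * mu.
    by apply: Rmult_lt_compat_r.
  have h2 : (4 * INR n * INR H + 4) / mu * mu = 4 * INR n * INR H + 4 by field; lra.
  have : (D.+1 <= N)%N by rewrite leq_pmulr.
  move/leq_INR; rewrite S_INR => h3.
  have : (INR D + 1) * mu <= INR N * mu by apply: Rmult_le_compat_r; lra.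
  by lra.
have nH_ge0 : 0 <= INR n * INR H by apply: Rmult_le_pos; apply: pos_INR.
have [|M [M1 M2]] := @nat_floor (INR N * mu - 2 * INR n * INR H); first lra.
pose f := grid_hit N H l.
have hM : {in ps, forall p, M <= \sum_(a < N) f (p * a)}%N.
  move=> p pps; have [pr_p _ pH] := psP p pps.
  have := @grid_hits p N H l (prime_gt0 pr_p) N_gt0 _ pH dis sub.
  move=> /(_ (dvdn_mull _ (dvdn_prod_mem pps))) h.
  by apply/leP; apply: INR_le; apply: Rle_trans M1 h.
have pf : periodic N f by apply: grid_hit_periodic.
have gps : all (fun p => [&& prime p, P <= p & p %| N])%N ps.
  apply/allP => p pps; have [-> /ltnW-> _] := psP p pps.
  exact: dvdn_mull (dvdn_prod_mem pps).
have bound := @missing_bound N f ps P k M N_gt0 P_gt0 pf (uniq_primes_in _ _) gps hM.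
pose s := [seq a <- iota 0 N | missing f ps a].
have size_s : size s = missing_count N f ps.
  rewrite size_filter -sum1_count big_mkcond /missing_count -/(index_iota 0 N).
  have -> : iota 0 N = index_iota 0 N by rewrite /index_iota subn0.
  by rewrite big_mkord; apply: eq_bigr => a _; case: (missing _ _ _).
exists N, s; split => //; last first.
  move=> alpha a01 bad; have [||a [aN ma abd]] := @missing_cell N H l ps alpha N_gt0 sub a01.
  - by move=> p /psP[/prime_gt0-> _ ->].
  - by move=> p /psP[pr_p _ pH]; apply: bad; rewrite prime_gt0.
  by exists a => //; rewrite mem_filter mem_iota ma.
have le_sN : (size s <= N)%N.
  by rewrite size_filter (leq_trans (count_size _ _)) // size_iota.
rewrite -size_s in bound; set E := size s in le_sN bound *.
have le_sum : (\sum_(p <- ps) p <= m * H)%N.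
  rewrite /m -sum1_size big_distrl /= big_seq [X in (_ <= X)%N]big_seq.
  by apply: leq_sum => p /psP[_ _]; rewrite mul1n.
have le_W : (size ps ^ k.+1 * N ^ 3 * (changes N f * \sum_(p <- ps) p) ^ 2 <=
    N ^ 3 * (P ^ k.+1) ^ 2)%N.
  rewrite [(_ * N ^ 3)%N]mulnC -mulnA leq_mul2l; apply/orP; right.
  apply: leq_trans le_PW; rewrite leq_mul2l leq_exp2r //; apply/orP; right.
  by apply: leq_mul => //; apply: changes_grid_hit.
(* The main term is at most [k N^3] because [E <= N], and by the hypothesis on [P] the remainder
   adds only one more [N^3]. *)
have : (m * E ^ 2 * M <= k.+1 * N ^ 3)%N.
  rewrite -(@leq_pmul2r ((P ^ k.+1) ^ 2)) ?expn_gt0 ?P_gt0 //.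
  apply: leq_trans bound _; apply: leq_trans (leq_add (leqnn _) le_W) _.
  rewrite -mulnDl leq_mul2r; apply/orP; right.
  rewrite mulSn addnC leq_add2l -mulnA leq_mul2l.
  by rewrite [(N ^ 3)%N]expnS leq_mul2r le_sN !orbT.
move/leq_INR; rewrite (mult_INR (m * E ^ 2) M) (mult_INR m (E ^ 2)) (mult_INR k.+1 (N ^ 3)).
rewrite !pow_INR_expn.
set x := INR E; set y := INR m; set z := INR N in NF Nmu M2 *; set w := INR M in M2 *.
have M_ge : z * mu / 2 <= w by lra.
have y_ge0 : 0 <= y by apply: pos_INR.
move=> h; apply: (Rmult_le_reg_r z) => //.
have : y * x ^ 2 * (z * mu / 2) <= y * x ^ 2 * w.
  by apply: Rmult_le_compat_l => //; apply: Rmult_le_pos => //; apply: pow2_ge_0.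
lra.
Qed.

(** * Choice of the parameters *)

Lemma poly_le_exp k : forall x C, 1 < x ->
  exists L0 : nat, forall L, (L0 <= L)%N -> C * INR L ^ k <= x ^ L.
Proof.
elim: k => [|k IHk] x C x_gt1.
  have [|L0 h] := @Pow_x_infinity x _ C; first by rewrite Rabs_right; lra.
  exists L0 => L /leP/h; rewrite Rabs_right /=; first lra.
  by apply: Rle_ge; apply: pow_le; lra.
(* With [x^L = s^L * s^L], one factor absorbs [L^k] by induction and the other the extra [L] by
   Bernoulli's inequality. *)
set s := sqrt x; have s_gt1 : 1 < s by rewrite /s -sqrt_1; apply: sqrt_lt_1; lra.
have ss : s * s = x by apply: sqrt_sqrt; lra.
have [L0 h] := IHk s (Rabs C / (s - 1)) s_gt1; exists L0 => L /h hL.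
have bern : INR L * (s - 1) <= s ^ L.
  have s1 : 0 < s - 1 by lra.
  have := poly L _ s1; have -> : 1 + (s - 1) = s by lra.
  lra.
have L_ge0 := pos_INR L; have Lk := pow_le _ k L_ge0.
rewrite -ss Rpow_mult_distr.
apply: (Rle_trans _ (Rabs C / (s - 1) * INR L ^ k * (INR L * (s - 1)))).
  have -> : Rabs C / (s - 1) * INR L ^ k * (INR L * (s - 1)) = Rabs C * INR L ^ k.+1.
    by rewrite /=; field; lra.
  by apply: Rmult_le_compat_r; [apply: pow_le | apply: Rle_abs].
apply: Rmult_le_compat => //; last by apply: Rmult_le_pos; lra.
apply: Rmult_le_pos => //; apply: Rmult_le_pos; first exact: Rabs_pos.
by apply: Rlt_le; apply: Rinv_0_lt_compat; lra.
Qed.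

Lemma ex_pow_gt x y : 1 < x -> exists k : nat, y < x ^ k.
Proof.
move=> x_gt1; have [L0 h] := @poly_le_exp 0 x (y + 1) x_gt1.
by exists L0; have := h L0 (leqnn _); rewrite /=; lra.
Qed.

Lemma half_bounds n : 2 * INR n./2 <= INR n <= 2 * INR n./2 + 1.
Proof.
have := congr1 INR (odd_double_half n); rewrite plus_INR -addnn plus_INR.
by case: (odd n) => /=; lra.
Qed.

(** The witness [P] is half the number [w] of primes up to [H]. At most [P + 1] of them are
    discarded, so about half remain, and [10 t <= H] absorbs the rounding. *)
Lemma many_primes H t : (0 < t)%N -> (H < 2 ^ t)%N -> (10 * t <= H)%N ->
  exists P, [/\ (0 < P)%N, INR H <= 8 * INR t * INR P,
    INR H <= 8 * INR t * INR (size (primes_in P.+1 H.+1)) &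
    (size (primes_in P.+1 H.+1) <= H)%N].
Proof.
move=> t_gt0 Ht tH; have cheb := chebyshev_lower_bound Ht.
set w := size (primes_in 0 H.+1) in cheb.
have wH : (w <= H.+1)%N by have := size_primes_in 0 H.+1; rewrite subn0.
have PH : (w./2.+1 <= H.+1)%N by rewrite ltnS; lia.
have /= split := @size_primes_in_cat 0 w./2.+1 H.+1 (leq0n _) PH.
have := size_primes_in 0 w./2.+1; have := size_primes_in w./2.+1 H.+1.
rewrite -/w in split; set m := size (primes_in w./2.+1 H.+1) in split *.
move=> m_le s_le; have m_ge : (w <= m + w./2 + 1)%N by lia.
have cF := leq_INR cheb; rewrite mult_INR in cF.
have mF := leq_INR m_ge; rewrite !plus_INR [INR 1]/= in mF.
have tF := leq_INR t_gt0; rewrite [INR 1]/= in tF.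
have tHF := leq_INR tH; rewrite mult_INR (_ : INR 10 = 10) in tHF; last by rewrite /=; lra.
have hw := half_bounds w; have hH := half_bounds H.
have k1 : INR H <= 2 * (INR t * INR w) + 1 by lra.
have k2 : INR H <= 8 * INR t * INR w./2 by nra.
have k3 : INR H <= 8 * INR t * INR m by nra.
exists w./2; split => //; last by lia.
rewrite lt0n; apply/eqP => w0; rewrite w0 /= in k2; lra.
Qed.

Lemma good_scale (A B eta delta : R) : 0 < A -> 0 < B -> 0 < eta -> 0 < delta ->
  exists k L0 : nat, forall (L n : nat) (mu : R), (L0 <= L)%N ->
    INR n <= A ^ L -> / (B ^ L) <= mu <= 1 ->
    exists H P : nat, let m := size (primes_in P.+1 H.+1) in
    [/\ (0 < H)%N, (0 < P)%N, INR H <= (1 + eta) ^ L * (1 / mu),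
      (m ^ k.+1 * (4 * n * (m * H)) ^ 2 <= (P ^ k.+1) ^ 2)%N &
      2 * INR k.+1 <= delta * (INR m * mu)].
Proof.
move=> A_gt0 B_gt0 eta_gt0 delta_gt0; set x := 1 + eta; have x_gt1 : 1 < x by rewrite /x; lra.
(* The choice of [c] gives [H <= (x B)^L < 2^t] for [t = (c + 1) L]. The choice of [J] makes [H^J]
   beat [A^(2L)] with a factor [2^L] to spare for powers of [t]. *)
have [c hc] : exists c, x * B < 2 ^ c by apply: ex_pow_gt; lra.
have [J hJ] := @ex_pow_gt x (2 * A ^ 2) x_gt1.
(* Then [2 (k + 1) = (k + 1) + 4 + J]: the left side of the condition on [P] uses [H^(k+1)] and
   [H^4], and [H^J] remains against [A^(2L)] and the logarithms. *)
pose k := (3 + J)%N; exists k.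
(* For [y = x^L] the four thresholds give in turn [H >= y / 2], [10 t <= H], the final bound
   involving [delta], and the domination of powers of [t] by [2^L]. *)
have [L1 h1] := @poly_le_exp 0 x 2 x_gt1.
have [L2 h2] := @poly_le_exp 1 x (20 * INR c.+1) x_gt1.
have [L3 h3] := @poly_le_exp 1 x (32 * INR k.+1 * INR c.+1 / delta) x_gt1.
have two_gt1 : 1 < 2 by lra.
have [L4 h4] := @poly_le_exp (2 * k.+1) 2 (16 * 2 ^ J * (8 * INR c.+1) ^ (2 * k.+1)) two_gt1.
exists (L1 + L2 + L3 + L4).+1 => L n mu leL nA [muB mu1].
have {}h1 := h1 L ltac:(lia); have {}h2 := h2 L ltac:(lia).
have {}h3 := h3 L ltac:(lia); have {}h4 := h4 L ltac:(lia).
rewrite /= in h1; rewrite !pow_1 in h2 h3.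
set y := x ^ L in h1 h2 h3 *.
have BL : 0 < B ^ L by apply: pow_lt.
have mu_gt0 : 0 < mu by have := Rinv_0_lt_compat _ BL; lra.
pose t := (c.+1 * L)%N; have tE : INR t = INR c.+1 * INR L by rewrite mult_INR.
have [|H [H1 H2]] := @nat_floor (y / mu).
  by apply: Rlt_le; apply: Rdiv_lt_0_compat; lra.
have ymu : y / mu * mu = y by field; lra.
have y_le : y <= y / mu by nra.
have mu_inv : / mu <= B ^ L.
  by rewrite -(Rinv_inv (B ^ L)); apply: Rinv_le_contravar => //; apply: Rinv_0_lt_compat.
have L_gt0 : (0 < L)%N by lia.
have t_gt0 : (0 < t)%N by rewrite muln_gt0.
have H_lt : (H < 2 ^ t)%N.
  apply: INR_ltn; rewrite pow_INR_expn (_ : INR 2 = 2) // /t.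
  have -> : (c.+1 * L)%N = Nat.mul c.+1 L by [].
  rewrite pow_mult; apply: Rle_lt_trans H1 _.
  apply: (Rle_lt_trans _ ((x * B) ^ L)).
    rewrite Rpow_mult_distr; apply: Rmult_le_compat_l => //; lra.
  apply: (Rle_lt_trans _ ((2 ^ c) ^ L)).
    by apply: pow_incr; split; [apply: Rmult_le_pos|]; lra.
  rewrite -!pow_mult; apply: Rlt_pow => //.
  by apply/ltP; change (c * L < c.+1 * L)%N; rewrite ltn_mul2r L_gt0 /=.
have tH : (10 * t <= H)%N.
  have i10 : INR 10 = 10 by rewrite /=; lra.
  by rewrite -ltnS; apply: INR_ltn; rewrite S_INR mult_INR tE i10; lra.
have [P [P_gt0 HP Hm mH]] := many_primes t_gt0 H_lt tH.
have H_gt0 : (0 < H)%N by apply: leq_trans tH; rewrite muln_gt0.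
exists H, P; set m := size _ in Hm mH *; split => //.
- by rewrite /Rdiv Rmult_1_l.
- apply/leP; apply: INR_le.
  have yJ : 16 * (A ^ L) ^ 2 * (8 * INR t) ^ (2 * k.+1) * 2 ^ J <= y ^ J.
    have e1 : y ^ J = (x ^ J) ^ L by rewrite /y -!pow_mult Nat.mul_comm.
    have e2 : (8 * INR t) ^ (2 * k.+1) = (8 * INR c.+1) ^ (2 * k.+1) * INR L ^ (2 * k.+1).
      by rewrite tE -Rpow_mult_distr; congr (_ ^ _); ring.
    apply: (Rle_trans _ ((2 * A ^ 2) ^ L)); last first.
      by rewrite e1; apply: pow_incr; split; [have := pow2_ge_0 A|]; lra.
    have e3 : (2 * A ^ 2) ^ L = (A ^ L) ^ 2 * 2 ^ L.
      by rewrite Rpow_mult_distr -!pow_mult Nat.mul_comm Rmult_comm.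
    have A2 : 0 <= (A ^ L) ^ 2 by apply: pow2_ge_0.
    rewrite e3 e2; have := Rmult_le_compat_l _ _ _ A2 h4; lra.
  have HJ : y ^ J <= 2 ^ J * INR H ^ J.
    by rewrite -Rpow_mult_distr; apply: pow_incr; lra.
  have J2 : 0 < 2 ^ J by apply: pow_lt; lra.
  have HF := pos_INR H; have mF := pos_INR m; have nF := pos_INR n.
  have HJ' : 16 * (A ^ L) ^ 2 * (8 * INR t) ^ (2 * k.+1) <= INR H ^ J.
    apply: (Rmult_le_reg_r (2 ^ J)) => //; lra.
  have tF : 0 < INR t by apply: (@ltn_INR 0).
  have T_gt0 : 0 < (8 * INR t) ^ (2 * k.+1) by apply: pow_lt; lra.
  have mHF := leq_INR mH.
  rewrite (mult_INR (m ^ k.+1)) !pow_INR_expn (mult_INR (4 * n)) (mult_INR 4) (mult_INR m).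
  have -> : INR 4 = 4 by rewrite /=; lra.
  apply: (Rle_trans _ (INR H ^ k.+1 * (4 * A ^ L * (INR H * INR H)) ^ 2)).
    apply: Rmult_le_compat; try by [apply: pow_le | apply: pow2_ge_0].
      exact: pow_incr.
    apply: pow_incr; split; first by apply: Rmult_le_pos; apply: Rmult_le_pos; lra.
    by apply: Rmult_le_compat; try (apply: Rmult_le_pos; lra);
      [apply: Rmult_le_compat_l; lra | apply: Rmult_le_compat_r; lra].
  apply: (Rmult_le_reg_l ((8 * INR t) ^ (2 * k.+1))) => //.
  apply: (Rle_trans _ (INR H ^ (2 * k.+1))); last first.
    rewrite -pow_mult Nat.mul_comm -Rpow_mult_distr; apply: pow_incr; lra.
  have e : INR H ^ (2 * k.+1) = INR H ^ k.+1 * INR H ^ 4 * INR H ^ J.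
    by rewrite -!pow_add; congr (_ ^ _); rewrite /k -!plusE; lia.
  rewrite e; set T := (8 * INR t) ^ _ in T_gt0 HJ' *.
  have -> : T * (INR H ^ k.+1 * (4 * A ^ L * (INR H * INR H)) ^ 2) =
    INR H ^ k.+1 * INR H ^ 4 * (16 * (A ^ L) ^ 2 * T) by ring.
  by apply: Rmult_le_compat_l => //; apply: Rmult_le_pos; apply: pow_le.
- have k1 : y - 1 <= INR H * mu by nra.
  have tF : 0 < INR t by apply: (@ltn_INR 0).
  have k2 : INR H * mu <= 8 * INR t * (INR m * mu) by nra.
  have k3 : 32 * INR k.+1 * INR t <= delta * y.
    have : delta * (32 * INR k.+1 * INR c.+1 / delta * INR L) <= delta * y.
      by apply: Rmult_le_compat_l; lra.
    have -> : delta * (32 * INR k.+1 * INR c.+1 / delta * INR L) = 32 * INR k.+1 * INR t.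
      by rewrite tE; field; lra.
    by [].
  apply: (Rmult_le_reg_l (16 * INR t)); first lra.
  apply: (Rle_trans _ (delta * y)); first lra.
  have -> : 16 * INR t * (delta * (INR m * mu)) = delta * (2 * (8 * INR t * (INR m * mu))) by ring.
  by apply: Rmult_le_compat_l; lra.
Qed.

(** * Null sets from finite covers *)

Definition width (s : seq (R * R)) : R := foldr (fun ab r => (ab.2 - ab.1) + r) 0 s.

(** This is outer Jordan content zero. *)
Definition finitely_covered (S : R -> Prop) : Prop := forall eps, 0 < eps ->
  exists s : seq (R * R), [/\ forall ab, List.In ab s -> ab.1 <= ab.2,
    forall x, S x -> exists2 ab, List.In ab s & ab.1 < x < ab.2 & width s <= eps].

Lemma width_cat s1 s2 : width (s1 ++ s2) = width s1 + width s2.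
Proof. by elim: s1 => [|ab s IHs] /=; [rewrite Rplus_0_l | rewrite IHs Rplus_assoc]. Qed.

Lemma width_ge0 s : (forall ab, List.In ab s -> ab.1 <= ab.2) -> 0 <= width s.
Proof.
elim: s => [|ab s IHs] /= h; first lra.
have := h ab (or_introl (erefl _)); have : 0 <= width s by apply: IHs => cd ?; apply: h; right.
lra.
Qed.

Lemma sum_f_width s m : (m < size s)%N ->
  sum_f_R0 (fun n => (nth (0, 0) s n).2 - (nth (0, 0) s n).1) m = width (take m.+1 s).
Proof.
elim: m => [|m IHm] ms; first by case: s ms => //= ab s _; rewrite take0 /=; lra.
rewrite /= IHm 1?ltnW // [in RHS](take_nth (0, 0)) // -cats1 width_cat /=; lra.
Qed.

Lemma sum_geometric_le eps m : 0 < eps ->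
  sum_f_R0 (fun j => eps / 2 ^ j.+1) m <= eps - eps / 2 ^ m.+1.
Proof.
move=> eps_gt0; elim: m => [|m IHm]; first by rewrite /=; lra.
rewrite tech5; apply: (Rle_trans _ (eps - eps / 2 ^ m.+1 + eps / 2 ^ m.+2)); first lra.
have h : 2 ^ m.+1 <> 0 by apply: pow_nonzero; lra.
have -> : eps / 2 ^ m.+2 = eps / 2 ^ m.+1 / 2 
  by have -> : 2 ^ m.+2 = 2 * 2 ^ m.+1 by []; field.
lra.
Qed.

Lemma In_nth_seq (T : Type) (d x : T) s : List.In x s ->
  exists2 n, (n < size s)%N & nth d s n = x.
Proof.
elim: s => //= y s IHs [->|/IHs[n ns <-]]; first by exists 0%N.
by exists n.+1.
Qed.

Lemma nth_In_seq (T : Type) (d : T) s n : (n < size s)%N -> List.In (nth d s n) s.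
Proof. by elim: s n => [|y s IHs] [|n] //= ns; [left | right; apply: IHs]. Qed.

Section Concatenation.
Context (u : nat -> seq (R * R)) (u_gt0 : forall j, (0 < size (u j))%N).

Fixpoint concat_upto m : seq (R * R) :=
  if m is m'.+1 then concat_upto m' ++ u m' else [::].

(** All blocks being nonempty, the first [n + 1] of them hold more than [n] entries, so the default
    value is never reached. *)
Definition concat_nth n := nth (0, 0) (concat_upto n.+1) n.

Lemma size_concat_upto m : (m <= size (concat_upto m))%N.
Proof. by elim: m => //= m IHm; rewrite size_cat; have := u_gt0 m; lia. Qed.

Lemma nth_concat_upto m k n : (n < size (concat_upto m))%N ->
  nth (0, 0) (concat_upto (m + k)) n = nth (0, 0) (concat_upto m) n.
Proof.
move=> nm; have le_m j : (size (concat_upto m) <= size (concat_upto (m + j)))%N.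
  by elim: j => [|j IHj]; rewrite ?addn0 // addnS /= size_cat (leq_trans IHj) ?leq_addr.
elim: k => [|k IHk]; first by rewrite addn0.
by rewrite addnS /= nth_cat (leq_trans nm (le_m k)).
Qed.

Lemma concat_nthE m n : (n < size (concat_upto m))%N ->
  concat_nth n = nth (0, 0) (concat_upto m) n.
Proof.
move=> nm; have nn : (n < size (concat_upto n.+1))%N by apply: size_concat_upto.
case: (leqP n.+1 m) => h.
  by rewrite -(subnKC h) nth_concat_upto.
by rewrite /concat_nth -(subnKC (ltnW h)) nth_concat_upto.
Qed.

Lemma In_concat_upto m ab : List.In ab (concat_upto m) -> exists j, List.In ab (u j).
Proof.
elim: m => //= m IHm /List.in_app_iff[/IHm //|h]; by exists m.
Qed.

Lemma concat_nth_In n : exists j, List.In (concat_nth n) (u j).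
Proof. by apply: (@In_concat_upto n.+1); apply: nth_In_seq; apply: size_concat_upto. Qed.

Lemma In_concat_nth j ab : List.In ab (u j) -> exists n, concat_nth n = ab.
Proof.
move=> abj; have : List.In ab (concat_upto j.+1) by apply/List.in_app_iff; right.
by case/(In_nth_seq (0, 0)) => n nj <-; exists n; apply: concat_nthE.
Qed.

Lemma width_concat_upto m : width (concat_upto m.+1) = sum_f_R0 (fun j => width (u j)) m.
Proof.
elim: m => [|m IHm] //.
by rewrite [concat_upto m.+2]/= -/(concat_upto m.+1) width_cat IHm tech5.
Qed.

End Concatenation.

Lemma null_of_finitely_covered (S : nat -> R -> Prop) :
  (forall j, finitely_covered (S j)) -> lebesgue_null (fun x => exists j, S j x).
Proof.
move=> cov eps eps_gt0.
have ex j : exists s : seq (R * R), [/\ (0 < size s)%N,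
    forall ab, List.In ab s -> ab.1 <= ab.2,
    forall x, S j x -> exists2 ab, List.In ab s & ab.1 < x < ab.2 &
    width s <= eps / 2 ^ j.+1].
  have [|s [h1 h2 h3]] := cov j (eps / 2 ^ j.+1).
    by apply: Rdiv_lt_0_compat => //; apply: pow_lt; lra.
  (* A degenerate interval makes the block nonempty without adding width. *)
  exists ((0, 0) :: s); split => //.
  - by move=> ab [<-|/h1 //] /=; lra.
  - by move=> x /h2[ab abs abx]; exists ab => //; right.
  - by have -> : width ((0, 0) :: s) = width s by rewrite /=; lra.
pose u j := proj1_sig (constructive_indefinite_description _ (ex j)).
have uP j := proj2_sig (constructive_indefinite_description _ (ex j)).
have u_gt0 j : (0 < size (u j))%N by have [] := uP j.
have u_le j ab : List.In ab (u j) -> ab.1 <= ab.2 by have [_ h _ _] := uP j; apply: h.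
exists (fun n => (concat_nth u n).1), (fun n => (concat_nth u n).2); split; [|split].
- by move=> n; have [j /u_le] := concat_nth_In u_gt0 n.
- move=> x [j Sx]; have [_ _ h _] := uP j; have [ab abu abx] := h x Sx.
  by have [n E] := In_concat_nth u_gt0 abu; exists n; rewrite E.
move=> m; have szm : (m < size (concat_upto u m.+1))%N by apply: size_concat_upto.
rewrite (@PartSum.sum_eq _ (fun n => (nth (0, 0) (concat_upto u m.+1) n).2 -
    (nth (0, 0) (concat_upto u m.+1) n).1)); last first.
  move=> n /leP nm; rewrite (@concat_nthE u u_gt0 m.+1) //.
  exact: leq_ltn_trans nm szm.
rewrite sum_f_width //.
(* The first [m + 1] intervals lie within the first [m + 1] blocks, and the entries left over have
   nonnegative width. *)
apply: (Rle_trans _ (width (concat_upto u m.+1))).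
  rewrite -[X in _ <= width X](cat_take_drop m.+1) width_cat.
  suff : 0 <= width (drop m.+1 (concat_upto u m.+1)) by lra.
  apply: width_ge0 => ab abd; have : List.In ab (concat_upto u m.+1).
    by rewrite -(cat_take_drop m.+1 (concat_upto u m.+1)); apply/List.in_app_iff; right.
  by case/In_concat_upto => j /u_le.
rewrite width_concat_upto.
apply: (Rle_trans _ (sum_f_R0 (fun j => eps / 2 ^ j.+1) m)).
  by apply: sum_Rle => j _; have [] := uP j.
have := sum_geometric_le m eps_gt0.
have : 0 < eps / 2 ^ m.+1 by apply: Rdiv_lt_0_compat => //; apply: pow_lt; lra.
lra.
Qed.

(** A bad [alpha] fails at every [L >= M], so a single large [L], chosen after [eps], already gives
    the cover; no summation over [L] occurs. *)
Lemma finitely_covered_bad (A B : R) (I : nat -> list interval) (eta : R) (M : nat) :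
  0 < A -> 0 < B ->
  (forall L, pairwise_disjoint (I L)) ->
  (forall L x, in_union (I L) x -> 0 <= x < 1) ->
  (forall L, INR (length (I L)) <= A ^ L) ->
  (forall L, total_length (I L) >= / (B ^ L)) -> 0 < eta ->
  finitely_covered (fun alpha => 0 <= alpha < 1 /\
    forall L, le M L -> forall h, lt 0 h ->
      INR h <= (1 + eta) ^ L * (1 / total_length (I L)) ->
      ~ in_union (I L) (frac_part (INR h * alpha))).
Proof.
move=> A_gt0 B_gt0 dis sub lenA muB eta_gt0 eps eps_gt0.
(* The cells in [s] are covered by intervals of length [2 / N], so [size s <= (eps / 2) N] is
   wanted, and the estimate bounds the square of [size s / N]. *)
have delta_gt0 : 0 < (eps / 2) ^ 2 by apply: pow_lt; lra.
have [k [L0 scale]] := good_scale A_gt0 B_gt0 eta_gt0 delta_gt0.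
pose L := (M + L0)%N; set mu := total_length (I L).
have [||H [P [H_gt0 P_gt0 leH cond big]]] := scale L (size (I L)) mu (leq_addl _ _).
- exact: lenA.
- by split; [apply: Rge_le; apply: muB | apply: total_length_le1 (dis L) (@sub L)].
have mu_gt0 : 0 < mu.
  have : 0 < / B ^ L by apply: Rinv_0_lt_compat; apply: pow_lt.
  by have := muB L; rewrite -/mu; lra.
have [N [s [N_gt0 small cover]]] :=
  cover_of_bad H_gt0 P_gt0 (dis L) (@sub L) mu_gt0 cond.
rewrite -/mu in small; set m := size (primes_in _ _) in big small.
have NF : 0 < INR N by apply: (@ltn_INR 0).
(* A cell contains its left end, so it is widened to the left to fit in an open interval. *)
exists [seq ((INR a - 1) / INR N, (INR a + 1) / INR N) | a <- s]; split.
- move=> ab /List.in_map_iff[a [<- _]] /=.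
  apply: Rmult_le_compat_r; first by apply: Rlt_le; apply: Rinv_0_lt_compat.
  lra.
- move=> x [x01 bad]; have [h /andP[h_gt0 hH]|a sa [a1 a2]] := cover x x01.
    apply: bad; [exact/leP/leq_addr | exact/ltP | ].
    exact: Rle_trans (leq_INR hH) leH.
  exists ((INR a - 1) / INR N, (INR a + 1) / INR N).
    apply/List.in_map_iff; exists a; split => //.
    by elim: (s) sa => //= b s' IHs; rewrite inE => /orP[/eqP->|/IHs]; [left|right].
  split; rewrite /=; apply: (Rmult_lt_reg_r (INR N)) => //.
    have -> : (INR a - 1) / INR N * INR N = INR a - 1 by field; lra.
    lra.
  have -> : (INR a + 1) / INR N * INR N = INR a + 1 by field; lra.
  lra.
have -> : width [seq ((INR a - 1) / INR N, (INR a + 1) / INR N) | a <- s] =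
    2 * INR (size s) / INR N.
  elim: (s) => [|a s' IHs]; first by rewrite /=; field; lra.
  rewrite [size _]/= S_INR [width _]/= -/(width _) IHs; field; lra.
have mmu : 0 < INR m * mu.
  have := pos_INR k.+1; rewrite S_INR; have := pos_INR k => k0 _.
  rewrite S_INR in big; apply: Rnot_le_lt => h; nra.
have sq : INR (size s) ^ 2 <= (eps / 2 * INR N) ^ 2.
  apply: (Rmult_le_reg_r (INR m * mu)) => //; apply: Rle_trans small _.
  rewrite Rpow_mult_distr; have : 0 <= INR N ^ 2 by apply: pow2_ge_0.
  nra.
have : INR (size s) <= eps / 2 * INR N.
  apply: Rnot_lt_le => h; have := pos_INR (size s) => s0.
  have : 0 <= eps / 2 * INR N by nra.
  nra.
move=> h; apply: (Rmult_le_reg_r (INR N)) => //.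
have -> : 2 * INR (size s) / INR N * INR N = 2 * INR (size s) by field; lra.
lra.
Qed.

End Covers.

(* The exceptional set as a countable union *)
Require Import Defs.
From Stdlib Require Import Reals List.
From Stdlib Require Import Lra Lia Classical.
Open Scope R_scope.

Theorem theorem4 (A B : R) (I : nat -> list interval) :
  0 < A -> 0 < B ->
  (forall L, pairwise_disjoint (I L)) ->
  (forall L x, in_union (I L) x -> 0 <= x < 1) ->
  (forall L, INR (length (I L)) <= A ^ L) ->
  (forall L, total_length (I L) >= / (B ^ L)) ->
  exists N : R -> Prop, lebesgue_null N /\
    forall alpha, 0 <= alpha < 1 -> ~ N alpha ->
    forall eta, 0 < eta ->
    forall M : nat, exists L : nat, (M <= L)%nat /\
      exists h : nat, (0 < h)%nat /\
        INR h <= (1 + eta) ^ L * (1 / total_length (I L)) /\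
        in_union (I L) (frac_part (INR h * alpha)).
Proof.
  intros HA HB Hdis Hsub Hlen Hmu.
  (* One index [j] serves both as the threshold for [L] and, through [1 / (j + 1)], as the value of
     [eta]. *)
  set (S := fun (j : nat) (alpha : R) => 0 <= alpha < 1 /\
    forall L, (j <= L)%nat -> forall h, (0 < h)%nat ->
      INR h <= (1 + / INR (j + 1)) ^ L * (1 / total_length (I L)) ->
      ~ in_union (I L) (frac_part (INR h * alpha))).
  exists (fun alpha => exists j, S j alpha). split.
  - apply Covers.null_of_finitely_covered. intro j.
    apply (@Covers.finitely_covered_bad A B); auto.
    apply Rinv_0_lt_compat, lt_0_INR. lia.
  - intros alpha Ha HN eta Heta M. apply NNPP. intro Hno. apply HN.
    destruct (archimed_cor1 eta Heta) as [n [Hn Hn0]].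
    (* This index is at least [M], and [1 / (M + n + 1) <= 1 / n < eta]. *)
    exists (M + n)%nat. split; [exact Ha |].
    intros L HL h Hh Hle Hin. apply Hno.
    exists L. split; [lia |]. exists h. repeat split; auto.
    apply (Rle_trans _ _ _ Hle). apply Rmult_le_compat_r.
    + apply Rmult_le_pos; [lra |].
      apply Rlt_le, Rinv_0_lt_compat.
      assert (0 < / B ^ L) by (apply Rinv_0_lt_compat, pow_lt, HB).
      specialize (Hmu L). lra.
    + assert (/ INR (M + n + 1) <= / INR n).
      { apply Rinv_le_contravar; [apply lt_0_INR; lia | apply le_INR; lia]. }
      assert (0 < / INR (M + n + 1)) by (apply Rinv_0_lt_compat, lt_0_INR; lia).
      apply pow_incr. lra.
Qed.
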